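(* Let $\alpha>0$ and $\xi<0$. Let $c_0$ be the linear functional associated to the measure $(x-\xi)x^{\alpha-1}e^{-x}dx$ on $]0,+\infty[$ and $c_1$ the one associated to $x^{\alpha}e^{-x}dx$ on $]0,+\infty[$. For every $n\ge1$, $$c_1((p')^2)\le\frac1{\mu_{1,n}}\,c_0(p^2)\qquad\text{for all }p\in\mathcal P_n,$$ where $\mu_{1,n}$ is the smallest zero of the polynomial $A_n(\lambda)$ satisfying the three term recurrence relation $$A_n(\lambda)=\Big(\lambda-2+\frac{\xi-\alpha}{n}\Big)A_{n-1}(\lambda)-\Big(1+\frac{\alpha}{n-1}\Big)A_{n-2}(\lambda),\quad n\ge2,$$ with $A_0(\lambda)=1$ and $A_1(\lambda)=\lambda-\alpha-1+\xi-\frac{\xi}{\xi-\alpha}$.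
   Context: $\mathcal P_n$ is the space of real polynomials in one variable of degree at most $n$. The linear functional associated to a measure $d\mu$ is $p\mapsto\int p\,d\mu$. The zeros of $A_n$ are real and positive. *)

(* Defs.v *)
From HB Require Import structures.
From mathcomp Require Import all_boot all_order all_algebra.
From mathcomp Require Import all_classical all_reals all_analysis.

Set Implicit Arguments.
Unset Strict Implicit.
Unset Printing Implicit Defensive.

Import Order.TTheory GRing.Theory Num.Theory.
Import numFieldNormedType.Exports.

Local Open Scope classical_set_scope.
Local Open Scope ring_scope.

(* The functional p |-> \int p(x) w(x) dx over ]0, +oo[, a Lebesgue integral.
   [Rintegral] is total: its value is meaningful when the integrand is
   integrable, which is the case for every polynomial p and the two weights
   below as soon as 0 < alpha. *)
Definition weight_functional (R : realType) (w : R -> R) (p : {poly R}) : R :=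
  \int[lebesgue_measure]_(x in `]0, +oo[) (p.[x] * w x).

Definition c0 (R : realType) (alpha xi : R) : {poly R} -> R :=
  weight_functional (fun x => (x - xi) * x `^ (alpha - 1) * expR (- x)).

Definition c1 (R : realType) (alpha : R) : {poly R} -> R :=
  weight_functional (fun x => x `^ alpha * expR (- x)).

(* In the last branch the degree is n = m.+2, so that n - 1 = m.+1. *)
Fixpoint A (R : realType) (alpha xi : R) (n : nat) : {poly R} :=
  match n with
  | 0 => 1
  | 1 => 'X + (- alpha - 1 + xi - xi / (xi - alpha))%:P
  | (m.+1 as m1).+1 =>
      ('X + (- 2%:R + (xi - alpha) / m.+2%:R)%:P) * A alpha xi m1
      - (1 + alpha / m.+1%:R) *: A alpha xi m
  end.

Definition smallest_zero (R : realType) (p : {poly R}) (mu : R) : Prop :=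
  root p mu /\ forall x : R, root p x -> mu <= x.

(* Main.v *)
(* Let q_k be the Laguerre polynomials of parameter alpha - 1, orthogonal for
   E(p) = \int p x^(alpha-1) e^-x, and e_k = E(q_k^2). Their differential equation
   gives c1(p' q_k') = k E(p q_k), so c1 is diagonal on the derivatives q_k'; the
   three-term recurrence makes c0 tridiagonal on the q_k. Normalizing q_k by
   c1(q_k'^2) = k e_k and eliminating the constant q_0 turns the quotient
   c0(p^2) / c1(p'^2) into the Rayleigh quotient of a Jacobi matrix J whose
   characteristic polynomial is A_n. To bound the form by elimination, note that
   (-1)^k A_k(mu) > 0 for k < n at the smallest zero mu of A_n (interlacing), so
   the form c0(p^2) - mu c1(p'^2) has nonnegative pivots. All zeros are positive
   because (-1)^k A_k(x) grows with k when x <= 0. *)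
Require Import Defs.
From HB Require Import structures.
From mathcomp Require Import all_boot all_order all_algebra.
From mathcomp Require Import all_classical all_reals all_analysis.
From mathcomp Require Import polyrcf measurable_realfun ring lra.

Set Implicit Arguments.
Unset Strict Implicit.
Unset Printing Implicit Defensive.

Import Order.TTheory GRing.Theory Num.Theory.
Import numFieldNormedType.Exports.

Local Open Scope classical_set_scope.
Local Open Scope ring_scope.

(** * Gamma densities and their polynomial moments *)

Section GammaDensity.
Context {R : realType}.
Notation mu := (@lebesgue_measure R).

(** * Improper integrals on the open half-line *)

Lemma bigcup_itv_invS_bndy :
  \bigcup_i `[i.+1%:R^-1 : R, +oo[%classic = `]0, +oo[%classic.
Proof.
apply/seteqP; split=> x /=.
  case=> i _ /=; rewrite !in_itv /= !andbT.
  by apply: lt_le_trans; rewrite invr_gt0.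
rewrite in_itv/= andbT => x0.
exists (Num.trunc x^-1) => //=; rewrite in_itv/= andbT.
rewrite -[leRHS]invrK lef_pV2 ?posrE ?invr_gt0//.
by apply/ltW/truncnS_gt.
Qed.

(** The integrand may blow up at 0, so the fundamental theorem is applied on each half-line starting
    at 1/(i+1), and monotone convergence passes to the limit. *)
Lemma ge0_FTC2_oy (f F : R -> R) (l m : R) :
  (forall x : R, 0 < x -> 0 <= f x) ->
  (forall x : R, 0 < x -> {for x, continuous f}) ->
  (forall x : R, 0 < x -> is_derive x 1 F (f x)) ->
  F x @[x --> 0^'+] --> l -> F x @[x --> +oo] --> m ->
  (\int[mu]_(x in `]0%R, +oo[) (f x)%:E = m%:E - l%:E)%E.
Proof.
move=> f0 cf dF Fl Fm.
have iF (i : nat) : (\int[mu]_(x in `[(i.+1%:R^-1)%R, +oo[) (f x)%:E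
    = m%:E - (F i.+1%:R^-1)%:E)%E.
  have i0 : 0 < i.+1%:R^-1 :> R by rewrite invr_gt0.
  apply: ge0_continuous_FTC2y => //.
  - by move=> x xi; apply: f0; exact: lt_le_trans xi.
  - apply: continuous_in_subspaceT => x; rewrite inE/= in_itv/= andbT => xi.
    by apply: cf; exact: lt_le_trans xi.
  - by move=> x xi; have [] := dF x (lt_trans i0 xi).
  - apply: cvg_at_right_filter; apply: differentiable_continuous.
    by apply/derivable1_diffP; have [] := dF _ i0.
  - move=> x; rewrite in_itv/= andbT => xi.
    by rewrite derive1E; have [_ ->] := dF _ (lt_trans i0 xi).
have mf : measurable_fun `](0 : R), +oo[ f.
  apply: open_continuous_measurable_fun => //.
  by move=> x; rewrite inE/= in_itv/= andbT => /cf.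
have H : (\int[mu]_(x in `[(i.+1%:R^-1)%R, +oo[) (f x)%:E @[i --> \oo] -->
   \int[mu]_(x in `]0%R, +oo[) (f x)%:E)%E.
  rewrite -bigcup_itv_invS_bndy.
  apply: (ge0_nondecreasing_set_cvg_integral (mu := mu)) => //.
  - move=> i j ij; apply/subsetPset => x/=; rewrite !in_itv/= !andbT.
    by apply: le_trans; rewrite lef_pV2 ?posrE// ler_nat.
  - move=> i; apply/measurable_EFinP; apply: measurable_funS mf => //.
    by rewrite -bigcup_itv_invS_bndy; exact: (bigcup_sup (i := i)).
  - move=> i x; rewrite /= in_itv/= andbT => xi.
    by rewrite lee_fin f0//; apply: lt_le_trans xi; rewrite invr_gt0.
apply: (cvg_unique _ H) => //.
apply: cvg_trans
  (_ : (m%:E - (F i.+1%:R^-1)%:E)%E @[i --> \oo] --> (m%:E - l%:E)%E).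
  by apply: near_eq_cvg; apply: nearW => i; rewrite -iF.
under eq_fun do rewrite -EFinB.
rewrite -EFinB; apply: cvg_EFin; first exact: nearW.
rewrite /comp/=.
apply: cvgB; first exact: cvg_cst.
have /cvg_at_rightP := Fl; apply; split; first by move=> i; rewrite invr_gt0.
exact: cvg_harmonic.
Qed.


(** Half of the exponential absorbs the power; the other half stays available as an integrable
    majorant. *)
Lemma powR_expR_bounded (s : R) : 0 < s ->
  exists2 C, 0 < C & forall x, 0 < x -> x `^ s * expR (- (x / 2)) <= C.
Proof.
move=> s0; pose n := Num.trunc s.
have sn : s < n.+1%:R by exact: truncnS_gt.
exists (1 + 2 ^+ n.+1 * n.+1`!%:R).
  by rewrite addr_gt0// mulr_gt0 ?exprn_gt0// ltr0n fact_gt0.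
move=> x x0; rewrite expRN ler_pdivrMr ?expR_gt0//.
have x20 : 0 <= x / 2 by rewrite divr_ge0// ltW.
have e1 : 1 <= expR (x / 2) by rewrite -[leLHS]expR0 ler_expR.
have xn : x ^+ n.+1 <= 2 ^+ n.+1 * n.+1`!%:R * expR (x / 2).
  have h : (x / 2) ^+ n.+1 / n.+1`!%:R <= expR (x / 2).
    by apply: le_trans (expR_ge1Dxn n x20); rewrite lerDr.
  rewrite mulrAC -ler_pdivrMr ?ltr0n ?fact_gt0//.
  rewrite [leRHS]mulrC -ler_pdivrMr ?exprn_gt0// (le_trans _ h)//.
  by rewrite expr_div_n mulrAC.
have xs : x `^ s <= 1 + x ^+ n.+1.
  have [x1|x1] := leP x 1.
    apply: (@le_trans _ _ 1); last by rewrite lerDl exprn_ge0// ltW.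
    by rewrite -[leRHS](powRr0 x); apply: ger_powR; rewrite ?x0 ?x1 ?ltW.
  rewrite -powR_mulrn ?(ltW x0)//; apply: ler_wpDl => //.
  by apply: ler_powR; exact: ltW.
rewrite mulrDl mul1r; apply: (le_trans xs); exact: lerD.
Qed.

(** * Unnormalized Gamma densities of shape [s]: derivative, limits, integrability *)

Definition gamma_density (s x : R) : R := x `^ (s - 1) * expR (- x).

Lemma gamma_densityS (s x : R) : 0 < x ->
  gamma_density (s + 1) x = x * gamma_density s x.
Proof.
move=> x0; rewrite /gamma_density addrK mulrA.
rewrite -[X in _ = X * _ * _](powRr1 (ltW x0)).
by rewrite -powRD ?(addrC 1) ?subrK// (gt_eqF x0) ?implybT.
Qed.

Lemma gamma_density_gt0 (s x : R) : 0 < x -> 0 < gamma_density s x.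
Proof. by move=> x0; rewrite mulr_gt0 ?powR_gt0 ?expR_gt0. Qed.

Lemma is_derive_expRN (c x : R) :
  is_derive x 1 (fun x => expR (- (x * c))) (- c * expR (- (x * c))).
Proof.
have h : is_derive x 1 (fun x : R => - (x * c)) (- c).
  have -> : (fun x => - (x * c)) = - c \*: id.
    by apply/funext => y /=; rewrite mulrC -mulNr.
  by apply: is_derive_eq; rewrite /GRing.scale/= mulr1.
have := @is_derive1_comp _ expR _ _ _ _ (is_derive_expR _) h.
by rewrite mulrC.
Qed.

Lemma is_derive_gamma_density (s x : R) : 0 < x ->
  is_derive x 1 (gamma_density (s + 1))
    (s * gamma_density s x - gamma_density (s + 1) x).
Proof.
move=> x0.
have h1 : is_derive x 1 (fun x => x `^ s) (s * x `^ (s - 1)).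
  have xin : x \in `]0, +oo[ by rewrite in_itv/= x0.
  split; first exact: derivable_powR.
  by rewrite -derive1E powR_derive1.
have h2 := is_derive_expRN 1 x.
have -> : gamma_density (s + 1) =
    (fun x => x `^ s) * (fun x => expR (- (x * 1))).
  by apply/funext => y; rewrite /gamma_density addrK fctE mulr1.
apply: is_derive_eq.
rewrite /gamma_density fctE /GRing.scale/= !mulr1.
ring.
Qed.

Lemma continuous_gamma_density (s x : R) : 0 < x ->
  {for x, continuous (gamma_density s)}.
Proof.
move=> x0; apply: differentiable_continuous; apply/derivable1_diffP.
by rewrite -(subrK 1 s); have [] := is_derive_gamma_density (s - 1) x0.
Qed.

Lemma measurable_gamma_density (s : R) :
  measurable_fun `](0 : R), +oo[ (gamma_density s).
Proof.
apply: open_continuous_measurable_fun => //.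
by move=> x; rewrite inE/= in_itv/= andbT; exact: continuous_gamma_density.
Qed.

Lemma gamma_density_cvg0 (s : R) : 0 < s ->
  gamma_density (s + 1) x @[x --> 0^'+] --> (0 : R).
Proof.
move=> s0; rewrite -[X in _ --> X](mul0r (expR (- 0))).
rewrite /gamma_density addrK; apply: cvgM; first exact: powR_cvg0.
apply: cvg_at_right_filter; apply: continuous_comp; last exact: continuous_expR.
exact: opp_continuous.
Qed.

Lemma expRN_half_cvgy : expR (- (x / 2)) @[x --> +oo] --> (0 : R).
Proof.
apply: (cvg_comp (fun x : R => x / 2) (fun x => expR (- x)));
  last exact: cvgr_expR.
exact: gt0_cvgMly.
Qed.

Lemma gamma_density_cvgy (s : R) : 0 < s ->
  gamma_density (s + 1) x @[x --> +oo] --> (0 : R).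
Proof.
move=> s0; have [C C0 hC] := powR_expR_bounded s0.
apply: (@squeeze_cvgr _ _ _ _ (fun=> 0) (fun x => C * expR (- (x / 2)))).
- near=> x; have x0 : 0 < x by near: x; exact: nbhs_pinfty_gt.
  rewrite (ltW (gamma_density_gt0 _ x0))/= /gamma_density addrK.
  have -> : - x = - (x / 2) + - (x / 2) by lra.
  by rewrite expRD mulrA ler_wpM2r ?expR_ge0// hC.
- exact: cvg_cst.
- rewrite -[X in _ --> X](mulr0 C); apply: cvgMr; exact: expRN_half_cvgy.
Unshelve. all: end_near. Qed.

Lemma expRN_half_cvg0 : expR (- (x / 2)) @[x --> 0^'+] --> (1 : R).
Proof.
suff: expR (- (x / 2)) @[x --> 0^'+] --> expR (- ((0 : R) / 2)).
  by rewrite mul0r oppr0 expR0.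
apply: cvg_at_right_filter.
have : {for 0, continuous (fun x : R => expR (- (x / 2)))}; last by [].
apply: differentiable_continuous.
by apply/derivable1_diffP; have [] := is_derive_expRN 2^-1 0.
Qed.

Lemma integral_expRN_half (C : R) : 0 < C ->
  (\int[mu]_(x in `]0%R, +oo[) (C * expR (- (x / 2)))%:E = (2 * C)%:E)%E.
Proof.
move=> C0.
have -> : (2 * C)%:E = (0%:E - (- (2 * C))%:E)%E by rewrite -EFinB sub0r opprK.
apply: (ge0_FTC2_oy (F := fun x => - (2 * C) * expR (- (x / 2)))).
- by move=> x _; rewrite mulr_ge0 ?expR_ge0 ?ltW.
- move=> x _; apply: differentiable_continuous; apply/derivable1_diffP.
  have h := is_derive_expRN 2^-1 x.
  by apply: derivableM => //; case: h.
- move=> x _; have h := is_derive_expRN 2^-1 x.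
  have -> : (fun x => - (2 * C) * expR (- (x / 2))) =
    - (2 * C) \*: (fun x => expR (- (x / 2))) by [].
  apply: is_derive_eq; rewrite /GRing.scale/=; by field.
- rewrite -[X in _ --> X]mulr1; apply: cvgMr; exact: expRN_half_cvg0.
- rewrite -[X in _ --> X](mulr0 (- (2 * C))); apply: cvgMr.
  exact: expRN_half_cvgy.
Qed.

(* The function [gamma_density (s + 1) x - 2 C expR (- x / 2)] is bounded and its
   derivative dominates [s * gamma_density s x], whence integrability. *)
Lemma gamma_density_integrable_ibp (s : R) : 0 < s ->
  mu.-integrable `]0%R, +oo[ (EFin \o gamma_density s) /\
  \int[mu]_(x in `]0%R, +oo[)
    (s * gamma_density s x - gamma_density (s + 1) x) = 0.
Proof.
move=> s0; have [C C0 hC] := powR_expR_bounded s0.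
have wC x : 0 < x -> gamma_density (s + 1) x <= C * expR (- (x / 2)).
  move=> x0; rewrite /gamma_density addrK.
  have -> : - x = - (x / 2) + - (x / 2) by lra.
  by rewrite expRD mulrA ler_wpM2r ?expR_ge0// hC.
pose g x := C * expR (- (x / 2)).
(* Adding [g], the derivative of [- (2 * C) * expR (- (x / 2))], makes the integrand nonnegative, as
   [ge0_FTC2_oy] requires. *)
pose f x := s * gamma_density s x - gamma_density (s + 1) x + g x.
have fs x : 0 < x -> s * gamma_density s x <= f x.
  by move=> x0; rewrite /f -addrA lerDl addrC subr_ge0 wC.
have mg : measurable_fun `](0:R), +oo[ g.
  apply: open_continuous_measurable_fun => // x _.
  apply: differentiable_continuous; apply/derivable1_diffP.
  by apply: derivableM => //; have [] := is_derive_expRN 2^-1 x.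
have mf : measurable_fun `](0:R), +oo[ f.
  apply: measurable_funD => //; apply: measurable_funB;
    last exact: measurable_gamma_density.
  by apply: measurable_funM => //; exact: measurable_gamma_density.
have If : (\int[mu]_(x in `]0%R, +oo[) (f x)%:E = (2 * C)%:E)%E.
  have -> : (2 * C)%:E = (0%:E - (- (2 * C))%:E)%E.
    by rewrite -EFinB sub0r opprK.
  apply: (ge0_FTC2_oy
    (F := fun x => gamma_density (s + 1) x + - (2 * C) * expR (- (x / 2)))).
  - move=> x x0; apply: le_trans (fs _ x0).
    by rewrite mulr_ge0// ltW// gamma_density_gt0.
  - move=> x x0; apply: cvgD; last first.
      apply: differentiable_continuous; apply/derivable1_diffP.
      by apply: derivableM => //; have [] := is_derive_expRN 2^-1 x.
    apply: cvgB; last exact: continuous_gamma_density.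
    by apply: cvgMr; exact: continuous_gamma_density.
  - move=> x x0; have h := is_derive_expRN 2^-1 x.
    have h' := is_derive_gamma_density s x0.
    have -> : (fun x =>
        gamma_density (s + 1) x + - (2 * C) * expR (- (x / 2))) =
      gamma_density (s + 1) + (- (2 * C) \*: (fun x => expR (- (x / 2)))) by [].
    apply: is_derive_eq; rewrite /f /g /GRing.scale/=; by field.
  - rewrite -[X in _ --> X]add0r; apply: cvgD; first exact: gamma_density_cvg0.
    rewrite -[X in _ --> X]mulr1; apply: cvgMr; exact: expRN_half_cvg0.
  - rewrite -[X in _ --> X]add0r; apply: cvgD; first exact: gamma_density_cvgy.
    rewrite -[X in _ --> X](mulr0 (- (2 * C))); apply: cvgMr.
    exact: expRN_half_cvgy.
have gint : mu.-integrable `]0%R, +oo[ (EFin \o g).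
  apply/integrableP; split; first exact/measurable_EFinP.
  suff -> : (\int[mu]_(x in `]0%R, +oo[) `|(EFin \o g) x| = (2 * C)%:E)%E.
    by rewrite ltry.
  rewrite -integral_expRN_half//; apply: eq_integral => x _.
  by rewrite /= ger0_norm// mulr_ge0 ?expR_ge0 ?ltW.
have fint : mu.-integrable `]0%R, +oo[ (EFin \o f).
  apply/integrableP; split; first exact/measurable_EFinP.
  suff -> : (\int[mu]_(x in `]0%R, +oo[) `|(EFin \o f) x| = (2 * C)%:E)%E.
    by rewrite ltry.
  rewrite -If; apply: eq_integral => x.
  rewrite inE/= in_itv/= andbT => x0; rewrite /= ger0_norm//.
  apply: le_trans (fs _ x0).
  by rewrite mulr_ge0// ltW// gamma_density_gt0.
split.
  suff h : mu.-integrable `]0%R, +oo[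
      (EFin \o (fun x => s * gamma_density s x)).
    apply: eq_integrable (integrableZl _ s^-1 h) => //= x _.
    by rewrite -EFinM mulKf// gt_eqF.
  apply: le_integrable fint => //.
    apply/measurable_EFinP.
    by apply: measurable_funM => //; exact: measurable_gamma_density.
  move=> x; rewrite /= in_itv/= andbT => x0; rewrite lee_fin ger0_norm.
    by rewrite (le_trans (fs _ x0))// ler_norm.
  by rewrite mulr_ge0// ltW// gamma_density_gt0.
(* [f] and [g] both integrate to 2C, so their difference integrates to 0. *)
have -> : (fun x => s * gamma_density s x - gamma_density (s + 1) x) =
    (fun x => f x - g x).
  by apply/funext => x; rewrite /f addrK.
rewrite RintegralB//.
by rewrite /Rintegral If integral_expRN_half// subrr.
Qed.

(** * The functional induced on polynomials *)

Definition gamma_functional (s : R) : {poly R} -> R :=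
  weight_functional (gamma_density s).

Lemma integrable_horner_gamma_density (s : R) (p : {poly R}) : 0 < s ->
  mu.-integrable `]0%R, +oo[ (fun x => (p.[x] * gamma_density s x)%:E).
Proof.
elim/poly_ind: p s => [|p c IH] s s0.
  apply: (eq_integrable _ (cst 0%E)) => //; last exact: integrable0.
  by move=> x _; rewrite /= horner0 mul0r.
have s10 : 0 < s + 1 by exact: addr_gt0.
have [ws _] := gamma_density_integrable_ibp s0.
apply: eq_integrable (integrableD _ (IH _ s10) (integrableZl _ c ws)) => //.
move=> x; rewrite inE/= in_itv/= andbT => x0.
rewrite -EFinM -EFinD; congr EFin; rewrite gamma_densityS// hornerMXaddC.
by rewrite /=; ring.
Qed.

Lemma gamma_functionalMX (s : R) (p : {poly R}) :
  gamma_functional s ('X * p) = gamma_functional (s + 1) p.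
Proof.
apply: eq_Rintegral => x; rewrite inE/= in_itv/= andbT => x0.
by rewrite gamma_densityS// hornerM hornerX; ring.
Qed.

Lemma gamma_functionalD (s : R) (p q : {poly R}) : 0 < s ->
  gamma_functional s (p + q) = gamma_functional s p + gamma_functional s q.
Proof.
move=> s0; rewrite -RintegralD//; try exact: integrable_horner_gamma_density.
by apply: eq_Rintegral => x _; rewrite hornerD mulrDl.
Qed.

Lemma gamma_functionalZ (s c : R) (p : {poly R}) : 0 < s ->
  gamma_functional s (c *: p) = c * gamma_functional s p.
Proof.
move=> s0; rewrite -RintegralZl//; try exact: integrable_horner_gamma_density.
by apply: eq_Rintegral => x _; rewrite hornerZ -mulrA.
Qed.

(** The integrand is the derivative of [p] times the density of shape [s + 1], which vanishes at
    both ends. Multiplying [p] by ['X] amounts to raising [s] by one, so induction on [p] with [s]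
    generalized leaves calculus only for constants. *)
Lemma gamma_functional_ibp (s : R) (p : {poly R}) : 0 < s ->
  gamma_functional s ('X * p^`() + (s%:P - 'X) * p) = 0.
Proof.
elim/poly_ind: p s => [|p c IH] s s0.
  rewrite deriv0 !mulr0 addr0 -[0](scale0r 0) gamma_functionalZ//.
  by rewrite mul0r.
have s10 : 0 < s + 1 by exact: addr_gt0.
have -> : 'X * (p * 'X + c%:P)^`() + (s%:P - 'X) * (p * 'X + c%:P) =
    'X * ('X * p^`() + ((s + 1)%:P - 'X) * p) + c *: (s%:P - 'X).
  by rewrite derivD derivM derivX derivC -mul_polyC polyCD; ring.
rewrite gamma_functionalD// gamma_functionalMX IH// add0r gamma_functionalZ//.
suff -> : gamma_functional s (s%:P - 'X) = 0 by rewrite mulr0.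
have [_ h] := gamma_density_integrable_ibp s0; rewrite -[RHS]h.
apply: eq_Rintegral => x; rewrite inE/= in_itv/= andbT => x0.
by rewrite gamma_densityS// hornerD hornerN hornerC hornerX mulrBl.
Qed.

(** A zero integral would put ]0, 1[, where the density is positive, inside a null set. *)
Lemma gamma_functional1_gt0 (s : R) : 0 < s -> 0 < gamma_functional s 1.
Proof.
move=> s0; have [ws _] := gamma_density_integrable_ibp s0.
have w0 x : x \in `]0, +oo[%classic -> 0 <= gamma_density s x.
  by rewrite inE/= in_itv/= andbT => x0; rewrite ltW// gamma_density_gt0.
rewrite /gamma_functional /weight_functional.
under eq_Rintegral do rewrite hornerC mul1r.
rewrite lt_neqAle Rintegral_ge0 ?andbT; last first.
  by move=> x /mem_set/w0.
apply/eqP => h.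
have : (\int[mu]_(x in `]0%R, +oo[) `|(EFin \o gamma_density s) x| = 0)%E.
  transitivity (\int[mu]_(x in `]0%R, +oo[) (EFin \o gamma_density s) x)%E.
    by apply: eq_integral => x /w0 ?; rewrite /= ger0_norm.
  by rewrite -(fineK (integrable_fin_num _ ws))// [X in X%:E](esym h).
move/ae_eq_integral_abs => [//| |N [mN N0 sN]].
  by apply/measurable_EFinP; exact: measurable_gamma_density.
have : (mu `]0%R, 1%R[ <= mu N)%E.
  apply: le_measure; rewrite ?inE//= => x /=; rewrite in_itv/= => /andP[x0 _].
  apply: sN => /=; rewrite in_itv/= andbT => /(_ x0) [].
  by apply/eqP; rewrite gt_eqF// gamma_density_gt0.
by rewrite N0 lebesgue_measure_itv/= lte01 sube0 leNgt lte01.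
Qed.

(** Expressing [c1] and [c0] through one Gamma functional lets a single Laguerre family serve
    both. *)
Lemma c1E (a : R) (p : {poly R}) : c1 a p = gamma_functional a ('X * p).
Proof.
rewrite gamma_functionalMX; apply: eq_Rintegral => x _.
by rewrite /gamma_density addrK.
Qed.

Lemma c0E (a xi : R) (p : {poly R}) :
  c0 a xi p = gamma_functional a (('X - xi%:P) * p).
Proof.
by apply: eq_Rintegral => x _; rewrite /gamma_density hornerM hornerXsubC; ring.
Qed.

End GammaDensity.

(** * Laguerre polynomials for an abstract functional *)

Section LaguerrePolynomials.
Context {R : realFieldType} (a : R) (a0 : 0 < a).

Definition pochhammer (i : nat) : R := \prod_(j < i) (j%:R + a).

Lemma pochhammerS i : pochhammer i.+1 = pochhammer i * (i%:R + a).
Proof. by rewrite /pochhammer big_ord_recr. Qed.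

Lemma pochhammer_neq0 i : pochhammer i != 0.
Proof. by rewrite gt_eqF// prodr_gt0// => j _; rewrite ltr_wpDl. Qed.

(* The Kummer function 1F1(-k; a; x), a multiple of L_k^(a-1). *)
Definition laguerre (k : nat) : {poly R} :=
  \poly_(i < k.+1) ((-1) ^+ i * 'C(k, i)%:R / pochhammer i).

Lemma coef_laguerre k i :
  (laguerre k)`_i = (-1) ^+ i * 'C(k, i)%:R / pochhammer i.
Proof.
by rewrite coef_poly ltnS; case: leqP => // ki; rewrite bin_small// mulr0 mul0r.
Qed.

(** The subtraction is taken in [R], so no bound on [i] is needed: beyond [k] the binomials
    vanish. *)
Lemma mulr_bin_left k i :
  i.+1%:R * 'C(k, i.+1)%:R = (k%:R - i%:R) * 'C(k, i)%:R :> R.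
Proof.
rewrite -natrM mul_bin_left; have [ik|ki] := leqP i k.
  by rewrite natrM natrB.
by rewrite [in RHS]bin_small// bin_small// muln0 mulr0.
Qed.

Lemma mulr_bin_down k i :
  (k.+1%:R - i%:R) * 'C(k.+1, i)%:R = k.+1%:R * 'C(k, i)%:R :> R.
Proof.
rewrite -[RHS]natrM (mul_bin_down k.+1 i); have [ik|ki] := leqP i k.+1.
  by rewrite natrM natrB.
by rewrite bin_small// muln0 mulr0.
Qed.

Lemma size_laguerre k : size (laguerre k) = k.+1.
Proof.
rewrite size_poly_eq// binn mulr1 mulf_neq0//; first by rewrite signr_eq0.
by rewrite invr_eq0 pochhammer_neq0.
Qed.

Lemma laguerre0 : laguerre 0 = 1.
Proof.
apply/polyP => i; rewrite coef_laguerre coef1 bin0n.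
case: i => [|i]; rewrite /pochhammer ?big_ord0 ?mulr0 ?mul0r//.
by rewrite expr0 invr1 !mulr1.
Qed.

(** The ratio of consecutive hypergeometric coefficients; the differential equation, read
    coefficientwise, is this relation. *)
Lemma coef_laguerreS k i :
  i.+1%:R * (i%:R + a) * (laguerre k)`_i.+1 = (i%:R - k%:R) * (laguerre k)`_i.
Proof.
rewrite !coef_laguerre pochhammerS exprS.
have n1 := pochhammer_neq0 i.
have n2 : i%:R + a != 0 by rewrite gt_eqF// ltr_wpDl.
transitivity (- (-1) ^+ i * (i.+1%:R * 'C(k, i.+1)%:R) / pochhammer i).
  by field; rewrite n1 n2.
by rewrite mulr_bin_left; field.
Qed.

Lemma laguerre_ode k :
  'X * (laguerre k)^`()^`() + (a%:P - 'X) * (laguerre k)^`()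
  = - k%:R *: laguerre k.
Proof.
apply/polyP => i; rewrite mulrBl coefD coefB coefZ coefCM !coefXM !coef_deriv.
have q_natl j m : (laguerre k)`_j *+ m = m%:R * (laguerre k)`_j.
  by rewrite mulr_natl.
case: i => [|i] /=; rewrite ?q_natl.
  by have := coef_laguerreS k 0; lra.
by rewrite -mulrnAr q_natl; have := coef_laguerreS k i.+1; lra.
Qed.

(** With the common factor removed, each coefficient is a binomial identity following from Pascal's
    rule. At [k = 0] the value of [k.-1] is harmless, its coefficient being 0. *)
Lemma laguerre_recurrence k :
  'X * laguerre k = (2 * k%:R + a) *: laguerre k - k%:R *: laguerre k.-1
                    - (a + k%:R) *: laguerre k.+1.
Proof.
apply/polyP => i; rewrite coefXM !coefB !coefZ !coef_laguerre.
case: i => [|i] /=; rewrite ?bin0 ?expr0.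
  by rewrite /pochhammer big_ord0; lra.
have n1 := pochhammer_neq0 i.
have n2 : i%:R + a != 0 by rewrite gt_eqF// ltr_wpDl.
rewrite pochhammerS exprS.
transitivity ((-1) ^+ i / pochhammer i / (i%:R + a) *
  ((i%:R + a) * 'C(k, i)%:R)); first by field; rewrite n1 n2.
transitivity ((-1) ^+ i / pochhammer i / (i%:R + a) *
  ((a + k%:R) * 'C(k.+1, i.+1)%:R + k%:R * 'C(k.-1, i.+1)%:R
    - (2 * k%:R + a) * 'C(k, i.+1)%:R)); last by field; rewrite n1 n2.
congr (_ * _).
case: k => [|k] /=.
  by rewrite binS !bin0n; case: i {n1 n2} => [|i] /=; lra.
by have := mulr_bin_down k i; rewrite (binS k.+1) (binS k) !natrD; lra.
Qed.

(** * Orthogonality and norms, from linearity, integration by parts and positive mass alone *)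

Context (E : {poly R} -> R)
  (ED : forall p q : {poly R}, E (p + q) = E p + E q)
  (EZ : forall c (p : {poly R}), E (c *: p) = c * E p)
  (E_ibp : forall p, E ('X * p^`() + (a%:P - 'X) * p) = 0)
  (E1 : 0 < E 1).

Lemma functionalB p q : E (p - q) = E p - E q.
Proof. by rewrite ED -scaleN1r EZ mulN1r. Qed.

Lemma functional0 : E 0 = 0.
Proof. by rewrite -(scale0r 0) EZ mul0r. Qed.

Lemma E_deriv_laguerre k p :
  E ('X * (p^`() * (laguerre k)^`())) = k%:R * E (p * laguerre k).
Proof.
have := E_ibp (p * (laguerre k)^`()); rewrite derivM.
have -> : 'X * (p^`() * (laguerre k)^`() + p * (laguerre k)^`()^`()) +
    (a%:P - 'X) * (p * (laguerre k)^`()) = 'X * (p^`() * (laguerre k)^`()) +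
  p * ('X * (laguerre k)^`()^`() + (a%:P - 'X) * (laguerre k)^`()) by ring.
by rewrite laguerre_ode -scalerAr ED EZ; lra.
Qed.

(** The Laguerre operator is symmetric for [E] and has [laguerre k] as eigenvector for -k. It sends
    ['X^(j.+1)] to -(j+1) times itself plus a multiple of ['X^j], so induction on [j] works because
    k differs from j+1. *)
Lemma E_Xn_laguerre k j : (j < k)%N -> E ('X^j * laguerre k) = 0.
Proof.
move=> jk; have k0 : k%:R != 0 :> R by rewrite pnatr_eq0; case: k jk.
elim: j jk => [|j IH] jk.
  have := E_deriv_laguerre k 1.
  rewrite derivC mul0r mulr0 functional0 expr0 mul1r => /esym/eqP.
  by rewrite mulf_eq0 (negPf k0) => /eqP.
have kj : k%:R - j.+1%:R != 0 :> R by rewrite subr_eq0 eqr_nat gtn_eqF.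
have := E_ibp (('X^(j.+1))^`() * laguerre k).
rewrite derivM mulrDr addrAC ED E_deriv_laguerre.
have -> : 'X * (('X^(j.+1))^`()^`() * laguerre k)
    + (a%:P - 'X) * (('X^(j.+1))^`() * laguerre k)
  = (j.+1%:R * (j%:R + a)) *: ('X^j * laguerre k)
    - j.+1%:R *: ('X^(j.+1) * laguerre k).
  have hX : 'X * ('X^j)^`() = j%:R *: 'X^j :> {poly R}.
    rewrite derivXn scaler_nat mulrnAr.
    by case: j {IH jk kj} => [|j]; rewrite ?mulr0n// exprS.
  rewrite derivXn /= derivMn; rewrite -!mul_polyC in hX *.
  transitivity (('X * ('X^j)^`() * laguerre k
    + (a%:P - 'X) * ('X^j * laguerre k)) *+ j.+1); first by ring.
  rewrite hX exprS; ring.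
rewrite functionalB !EZ IH ?(ltnW jk)// mulr0 sub0r => h.
have /eqP : (k%:R - j.+1%:R) * E ('X^(j.+1) * laguerre k) = 0.
  by move: h; set e := E _; lra.
by rewrite mulf_eq0 (negPf kj) => /eqP.
Qed.

Lemma E_mul_laguerre k (p : {poly R}) :
  (size p <= k)%N -> E (p * laguerre k) = 0.
Proof.
move=> pk; rewrite -(coefK p) poly_def mulr_suml.
rewrite (big_morph E ED functional0) big1// => i _.
by rewrite -scalerAl EZ E_Xn_laguerre ?mulr0// (leq_trans _ pk).
Qed.

Definition laguerre_norm k := E (laguerre k ^+ 2).

Lemma E_laguerre_ortho i j : i != j -> E (laguerre i * laguerre j) = 0.
Proof.
case: ltngtP => // [ij|ji] _; first by rewrite E_mul_laguerre ?size_laguerre.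
by rewrite mulrC E_mul_laguerre ?size_laguerre.
Qed.

Lemma E_X_laguerreSl k :
  E ('X * laguerre k * laguerre k.+1) = - (a + k%:R) * laguerre_norm k.+1.
Proof.
rewrite laguerre_recurrence !mulrBl !functionalB -!scalerAl !EZ.
rewrite (@E_laguerre_ortho k) ?ltn_eqF//.
rewrite (@E_laguerre_ortho k.-1) ?ltn_eqF ?ltnS ?leq_pred//.
by rewrite !mulr0 subr0 sub0r mulNr /laguerre_norm expr2.
Qed.

Lemma E_X_laguerreSr k :
  E ('X * laguerre k.+1 * laguerre k) = - k.+1%:R * laguerre_norm k.
Proof.
rewrite laguerre_recurrence !mulrBl !functionalB -!scalerAl !EZ /=.
rewrite (@E_laguerre_ortho k.+1) ?gtn_eqF// (@E_laguerre_ortho k.+2) ?gtn_eqF//.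
by rewrite !mulr0 sub0r subr0 mulNr /laguerre_norm expr2.
Qed.

Lemma E_X_laguerre_sqr k :
  E ('X * laguerre k ^+ 2) = (2 * k%:R + a) * laguerre_norm k.
Proof.
rewrite expr2 mulrA laguerre_recurrence !mulrBl !functionalB -!scalerAl !EZ /=.
rewrite (@E_laguerre_ortho k.+1) ?gtn_eqF// mulr0 subr0 /laguerre_norm expr2.
case: k => [|k]; first by rewrite mul0r subr0.
by rewrite /= (@E_laguerre_ortho k) ?ltn_eqF// mulr0 subr0.
Qed.

(** The same moment is computed by expanding either ['X * laguerre k] or ['X * laguerre k.+1];
    comparison gives the ratio of norms, hence their positivity from [E1]. *)
Lemma laguerre_normS k :
  k.+1%:R * laguerre_norm k = (a + k%:R) * laguerre_norm k.+1.
Proof.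
have := E_X_laguerreSl k.
by rewrite mulrAC E_X_laguerreSr; lra.
Qed.

Lemma laguerre_norm_gt0 k : 0 < laguerre_norm k.
Proof.
elim: k => [|k IH]; first by rewrite /laguerre_norm laguerre0 expr1n.
have ak : 0 < a + k%:R by rewrite ltr_wpDr.
by rewrite -(pmulr_rgt0 _ ak) -laguerre_normS mulr_gt0.
Qed.

Lemma laguerre_split k (p : {poly R}) : (size p <= k.+1)%N ->
  exists c (r : {poly R}), (size r <= k)%N /\ p = c *: laguerre k + r.
Proof.
move=> pk; have l0 : (laguerre k)`_k != 0.
  have := lead_coef_eq0 (laguerre k).
  by rewrite /lead_coef size_laguerre /= -size_poly_eq0 size_laguerre => ->.
pose c := p`_k / (laguerre k)`_k.
exists c, (p - c *: laguerre k); split; last by rewrite addrC subrK.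
apply/leq_sizeP => j kj; rewrite coefB coefZ.
move: kj; rewrite leq_eqVlt => /predU1P[<-|kj]; first by rewrite divfK// subrr.
by rewrite !nth_default ?size_laguerre ?mulr0 ?subrr// (leq_trans pk).
Qed.

(** * The quadratic form in the Laguerre basis and its elimination *)

Context (xi t : R) (hxi : xi < 0).

(** For the Gamma functional of shape [a] this is c0(p^2) - t c1(p'^2), to be shown nonnegative when
    t is the smallest zero. *)
Definition sobolev_form (p : {poly R}) : R :=
  E (('X - xi%:P) * p ^+ 2) - t * E ('X * p^`() ^+ 2).

(** By orthogonality the cross terms in [xi] and in the derivatives vanish; only the one from
    multiplication by ['X] survives. *)
Lemma sobolev_formD k c (r : {poly R}) : (size r <= k)%N ->
  sobolev_form (c *: laguerre k + r) =
  c ^+ 2 * ((2 - t) * k%:R + (a - xi)) * laguerre_norm k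
  + 2 * c * E ('X * laguerre k * r) + sobolev_form r.
Proof.
move=> rk; rewrite /sobolev_form derivD derivZ.
have -> : ('X - xi%:P) * (c *: laguerre k + r) ^+ 2 =
    c ^+ 2 *: ('X * laguerre k ^+ 2) - (c ^+ 2 * xi) *: laguerre k ^+ 2
    + ((2 * c) *: ('X * laguerre k * r) - (2 * c * xi) *: (r * laguerre k)
    + ('X - xi%:P) * r ^+ 2).
  by rewrite -!mul_polyC; ring.
have -> : 'X * (c *: (laguerre k)^`() + r^`()) ^+ 2 =
    c ^+ 2 *: ('X * ((laguerre k)^`() * (laguerre k)^`()))
    + ((2 * c) *: ('X * (r^`() * (laguerre k)^`())) + 'X * r^`() ^+ 2).
  by rewrite -!mul_polyC; ring.
rewrite !(functionalB, ED, EZ) !E_deriv_laguerre -expr2 E_X_laguerre_sqr.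
by rewrite (E_mul_laguerre rk) -/(laguerre_norm k); ring.
Qed.

(** Tridiagonality: ['X * r] has degree at most [k], so [laguerre k.+1] couples only with
    [laguerre k]. *)
Lemma sobolev_formDD k c c' (r : {poly R}) : (size r <= k)%N ->
  sobolev_form (c *: laguerre k.+1 + (c' *: laguerre k + r)) =
  c ^+ 2 * ((2 - t) * k.+1%:R + (a - xi)) * laguerre_norm k.+1
  - 2 * c * c' * k.+1%:R * laguerre_norm k
  + sobolev_form (c' *: laguerre k + r).
Proof.
move=> rk; rewrite sobolev_formD; last first.
  rewrite (leq_trans (size_polyD _ _))// geq_max.
  rewrite (leq_trans (size_scale_leq _ _))/= ?size_laguerre//.
  exact: leq_trans rk _.
congr (_ + _); congr (_ + _).
rewrite mulrDr ED -scalerAr EZ E_X_laguerreSr.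
rewrite [_ * r](_ : _ = 'X * r * laguerre k.+1); last by ring.
rewrite E_mul_laguerre; first by ring.
by rewrite (leq_trans (size_polyMleq _ _))// size_polyX.
Qed.

(* [b] will be the sequence [fun n => (-1) ^+ n * (A a xi n).[t]]. *)
Context (b : nat -> R) (b0 : b 0 = 1)
  (b1 : b 1 = a + 1 - xi + xi / (xi - a) - t)
  (bSS : forall m, b m.+2 =
    (2 + (a - xi) / m.+2%:R - t) * b m.+1 - (1 + a / m.+1%:R) * b m).

(* One step of the LDL^T elimination of the tridiagonal form: the m-th pivot is
   proportional to [b m.+1 / b m]. *)
Lemma sobolev_form_ge m : (forall i, (i <= m)%N -> 0 < b i) ->
  forall c (r : {poly R}), (size r <= m.+1)%N ->
  m.+1%:R * laguerre_norm m.+1 * b m.+1 * c ^+ 2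
    <= b m * sobolev_form (c *: laguerre m.+1 + r).
Proof.
have D0 : 0 < a - xi by rewrite subr_gt0 (lt_trans hxi).
elim: m => [|m IH] bpos c r rk.
  have [c' [r' [r'0 ->]]] := laguerre_split rk.
  have {r'0 r'}-> : r' = 0 by apply/eqP; rewrite -size_poly_leq0.
  rewrite sobolev_formDD ?size_poly0// sobolev_formD ?size_poly0//.
  have -> : sobolev_form 0 = 0.
    by rewrite /sobolev_form deriv0 expr0n /= !mulr0 functional0 mulr0 subr0.
  have := laguerre_normS 0; rewrite mul1r addr0 => ->.
  rewrite !mulr0 functional0 b0 b1 !mulr0 !addr0 !add0r !mul1r.
  have := laguerre_norm_gt0 1; set e := laguerre_norm 1 => e0.
  have D1 : xi - a != 0 by rewrite lt_eqF// subr_lt0 -subr_gt0.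
  have D2 : a - xi != 0 by rewrite gt_eqF//.
  rewrite -subr_ge0.
  (* Completing the square eliminates the constant term [c']; this elimination is the source of
     [xi / (xi - a)] in [b 1]. *)
  rewrite (_ : _ - _ = e * a * (a - xi) * (c' - c / (a - xi)) ^+ 2);
    last by field; rewrite D1 D2.
  by rewrite mulr_ge0 ?sqr_ge0// !mulr_ge0// ltW.
have [c' [r' [r'k def_r]]] := laguerre_split rk.
have {IH} := IH (fun i im => bpos i (leqW im)) c' r' r'k; rewrite -def_r.
rewrite def_r sobolev_formDD// -def_r; set Q := sobolev_form r.
have bm := bpos m (leqnSn m); have bm1 := bpos m.+1 (leqnn _).
rewrite bSS.
have := laguerre_normS m.+1; set e1 := laguerre_norm m.+2.
have := laguerre_norm_gt0 m.+1; set e := laguerre_norm m.+1 => e0 he hQ.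
set k : R := m.+1%:R in he hQ *.
have k0 : 0 < k by rewrite ltr0n.
have k10 : 0 < m.+2%:R :> R by rewrite ltr0n.
have kS : m.+2%:R = k + 1 :> R by rewrite -natr1.
clearbody k.
have ak0 : 0 < a + k by rewrite addr_gt0.
have he1 : e1 = (k + 1) * e / (a + k).
  by rewrite -kS he mulrC mulKf// gt_eqF.
have k1' : k + 1 != 0 by rewrite -kS gt_eqF.
have k0' : k != 0 by rewrite gt_eqF.
have ak' : a + k != 0 by rewrite gt_eqF.
have bm' : b m != 0 by rewrite gt_eqF.
(* This sum equals the gap to be shown nonnegative: the rescaled induction hypothesis plus a
   completed square in [c']. The recurrence [bSS] makes the coefficients of [c ^+ 2] agree. *)
have : 0 <= b m.+1 / b m * (b m * Q - k * e * b m.+1 * c' ^+ 2) +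
     e / (k * b m) * (k * b m.+1 * c' - (k + 1) * b m * c) ^+ 2.
  apply: addr_ge0; last by rewrite mulr_ge0 ?sqr_ge0// divr_ge0 ?mulr_ge0 ?ltW.
  by apply: mulr_ge0; [rewrite divr_ge0 ?ltW | rewrite subr_ge0].
move=> sq_ge0; rewrite -subr_ge0 he1 kS; apply: (le_trans sq_ge0).
rewrite le_eqVlt; apply/orP; left; apply/eqP; field.
by rewrite k0' k1' ak' bm'.
Qed.

End LaguerrePolynomials.

(** * Zeros of [A] *)

Section ZerosOfA.
Context {R : realType} (a xi : R) (a0 : 0 < a) (hxi : xi < 0).

(* The sign makes [signedA n] the determinant of the n-th leading block of
   J - x, where J is the Jacobi matrix of the header. *)
Definition signedA (n : nat) (x : R) : R := (-1) ^+ n * (A a xi n).[x].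

Lemma signedA0 x : signedA 0 x = 1.
Proof. by rewrite /signedA /= hornerC mul1r. Qed.

Lemma signedA1 x : signedA 1 x = a + 1 - xi + xi / (xi - a) - x.
Proof. by rewrite /signedA /= hornerD hornerX hornerC; ring. Qed.

Lemma signedASS m x : signedA m.+2 x =
  (2 + (a - xi) / m.+2%:R - x) * signedA m.+1 x
  - (1 + a / m.+1%:R) * signedA m x.
Proof.
have -> : signedA m.+2 x = (-1) ^+ m.+2 *
    (('X + (- 2%:R + (xi - a) / m.+2%:R)%:P) * A a xi m.+1
      - (1 + a / m.+1%:R) *: A a xi m).[x] by [].
rewrite /signedA hornerD hornerN hornerM hornerZ.
by rewrite hornerD hornerX hornerC !exprS; ring.
Qed.

(** The growth factor is the coefficient of the subtracted term in the recurrence, so the increment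
    inequality reproduces itself with the extra nonnegative term
    [(- xi / n.+2%:R - x) * signedA n.+1 x]. *)
Lemma signedA_npos_lt n x : x <= 0 ->
  0 < signedA n x /\ (1 + a / n.+1%:R) * signedA n x < signedA n.+1 x.
Proof.
move=> x0; elim: n => [|n [IH1 IH2]].
  rewrite signedA0 signedA1 divr1 mulr1; split => //.
  have : 0 < xi / (xi - a).
    by rewrite nmulr_rgt0// invr_lt0 subr_lt0 (lt_trans hxi).
  by move: (xi / _) a0 hxi => u; lra.
have an : 0 < a / n.+2%:R by rewrite divr_gt0.
have an1 : 0 < a / n.+1%:R by rewrite divr_gt0.
have s1 : 0 < signedA n.+1 x.
  by apply: lt_trans IH2; rewrite mulr_gt0// addr_gt0.
split=> //; rewrite signedASS.
rewrite -subr_gt0; set d := (1 + a / n.+1%:R) * _ in IH2 *.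
rewrite (_ : _ - _ = (signedA n.+1 x - d)
    + (- xi / n.+2%:R - x) * signedA n.+1 x); last by ring.
rewrite ltr_wpDr ?subr_gt0// mulr_ge0 ?(ltW s1)// subr_ge0 (le_trans x0)//.
by rewrite divr_ge0// oppr_ge0 ltW.
Qed.

Lemma signedA_npos n x : x <= 0 -> 0 < signedA n x.
Proof. by move=> /(signedA_npos_lt n)[]. Qed.

(** The smallest zeros decrease strictly with [n]. Positivity of all predecessors up to and
    including [m] carries the induction and later provides the positive pivots. *)
Lemma smallest_zero_signedA n : (0 < n)%N -> exists m,
  [/\ 0 < m, signedA n m = 0, forall x, x < m -> 0 < signedA n x
    & forall k x, (k < n)%N -> x <= m -> 0 < signedA k x].
Proof.
case: n => // n _; elim: n => [|n [m [m0 sm0 spos slow]]].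
  exists (a + 1 - xi + xi / (xi - a)); split.
  - have : 0 < xi / (xi - a).
      by rewrite nmulr_rgt0// invr_lt0 subr_lt0 (lt_trans hxi).
    by move: (xi / _) a0 hxi => u; lra.
  - by rewrite signedA1 subrr.
  - by move=> x; rewrite signedA1 subr_gt0.
  - by move=> [|//] x _ _; rewrite signedA0.
(* [signedA n.+2] is positive at 0 and negative at the smallest zero [m] of
   [signedA n.+1], so its smallest zero lies between them. *)
pose P : {poly R} := (-1) ^+ n.+2 *: A a xi n.+2.
have PE x : P.[x] = signedA n.+2 x by rewrite hornerZ.
have P0 : 0 < P.[0] by rewrite PE signedA_npos.
have Pm : P.[m] < 0.
  rewrite PE signedASS sm0 mulr0 sub0r oppr_lt0 mulr_gt0 ?slow//.
  by rewrite addr_gt0// divr_gt0.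
have [y [y0m Py yroot]] : exists y,
    [/\ 0 < y < m, P.[y] = 0 & forall x, 0 < x < y -> P.[x] != 0].
  (* Either [P] is zero, or it has a first root before [m], or it has none there; the signs at 0 and
     [m] exclude the outer two cases. *)
  case: (next_rootP P 0 m) => [P00|y Pn0 Py y0m nr|c Pn0 _ nr].
  - by rewrite P00 horner0 ltxx in P0.
  - by exists y; split.
  - have P0m : P.[0] * P.[m] < 0 by rewrite pmulr_rlt0.
    have [z zm rz] := poly_ivtoo (ltW m0) P0m.
    by move: (nr z zm); rewrite rz.
exists y.
have /andP[y0 ym] := y0m.
split=> // [|x xy|k x kn xy].
- by rewrite -PE.
- have [x0|x0] := leP x 0; first exact: signedA_npos.
  rewrite -PE; case: (ltgtP P.[x] 0) => // Px.
    have P0x : P.[0] * P.[x] < 0 by rewrite pmulr_rlt0.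
    have [z] := poly_ivtoo (ltW x0) P0x; rewrite in_itv/= => /andP[z0 zx] rz.
    by have := yroot z; rewrite z0 (lt_trans zx xy) (eqP rz) eqxx => /(_ isT).
  by have := yroot x; rewrite x0 xy Px eqxx => /(_ isT).
- have xm := le_lt_trans xy ym.
  move: kn; rewrite ltnS leq_eqVlt => /predU1P[->|kn]; first exact: spos.
  exact: slow kn (ltW xm).
Qed.

End ZerosOfA.

(** * The inequality at the smallest zero *)

Theorem theorem2p2 (R : realType) (alpha xi : R) (halpha : 0 < alpha)
    (hxi : xi < 0) (n : nat) (hn : (1 <= n)%N) :
  exists2 mu : R, smallest_zero (A alpha xi n) mu &
    forall p : {poly R}, (size p <= n.+1)%N ->
      c1 alpha (p^`() ^+ 2) <= 1 / mu * c0 alpha xi (p ^+ 2).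
Proof.
have [t [t0 At0 Apos Alow]] := smallest_zero_signedA halpha hxi hn.
exists t.
  split; first by move/eqP: At0; rewrite /signedA mulf_eq0 signr_eq0.
  move=> x /eqP rx; rewrite leNgt; apply/negP => /Apos.
  by rewrite /signedA rx mulr0 ltxx.
case: n hn At0 Apos Alow => // n _ At0 Apos Alow p sp.
have ED p q := gamma_functionalD p q halpha.
have EZ c p := gamma_functionalZ c p halpha.
have E_ibp p := gamma_functional_ibp p halpha.
have E1 := gamma_functional1_gt0 halpha.
have [c [r [rn ->]]] := laguerre_split halpha sp.
have := @sobolev_form_ge _ _ halpha _ ED EZ E_ibp E1 xi t hxi
  (fun k => signedA alpha xi k t) (signedA0 _ _ _) (signedA1 _ _ _)
  (fun m => signedASS _ _ _ _) n (fun i ik => Alow i t ik (lexx t)) c r rn.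
(* The last pivot vanishes because [t] is a zero, so the lower bound is 0, and the factor
   [signedA alpha xi n t] in front of the form is positive. *)
rewrite At0 mulr0 mul0r pmulr_rge0; last exact: Alow.
by rewrite /sobolev_form subr_ge0 div1r ler_pdivlMl// c1E c0E.
Qed.
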